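(* For every positive integer $n$ there exists a staged assembly system with temperature $\tau=2$ that (uniquely) assembles a fully connected $n\times n$ square, using $\mathcal{O}(\log n)$ stages, $4$ glues, $14$ tile types and $7$ bins.
   Context: Staged tile assembly model (two-handed, staged). A tile is a non-rotatable unit square carrying on each of its four sides (north, east, south, west) a glue from a finite alphabet $\Sigma$ containing a special null glue. A glue function $G:\Sigma^2\to\{0,1,\dots,\tau\}$ is symmetric, with $G(\mathrm{null},x)=0$; $\tau$ is a positive integer, the temperature. The glue complexity is the number of non-null glues used, the tile complexity the number of distinct tile types. A supertile is a finite edge-connected set of tiles placed at positions of $\mathbb{Z}^2$. Two supertiles combine if they can be placed next to each other by translation only (no rotation, no overlap) such that the sum of $G$-values of the glue pairs on all newly coincident edges is at least $\tau$. A bin is a set of initial supertiles; its produced supertiles are the closure under combination, and its terminal supertiles are those produced supertiles that cannot combine with any produced supertile. A staged assembly system with $r$ stages and $b$ bins per stage: each bin of stage 1 receives a set of tile types; each bin of stage $i\ge 2$ receives the union of the terminal supertiles of some bins of stage $i-1$, plus possibly additional tile types; the output is the union of the terminal supertiles of selected bins of stage $r$. The system uniquely assembles a shape if the terminal supertiles in every bin are unique and the output is a single supertile of that shape. The stage complexity is $r$ and the bin complexity is $b$. A supertile is fully connected if every two (horizontally or vertically) adjacent tiles in it share a glue of positive strength on their common edge. *)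

(* Defs.v *)
From Stdlib Require Import ZArith List Arith.
Import ListNotations.

Definition glue := nat.
Definition null_glue : glue := 0%nat.

Record tile := Tile { gN : glue; gE : glue; gS : glue; gW : glue }.

Definition tile_eq_dec (t u : tile) : {t = u} + {t <> u}.
Proof. decide equality; apply Nat.eq_dec. Defined.

Definition glue_fn := glue -> glue -> nat.

Definition valid_glue_fn (tau : nat) (G : glue_fn) : Prop :=
  (forall x y, G x y = G y x) /\
  (forall x, G null_glue x = 0%nat) /\
  (forall x y, (G x y <= tau)%nat).

(* Positions in Z^2; the y-coordinate grows to the north. *)
Definition pos := (Z * Z)%type.

(* A supertile is a finite set of placed tiles, represented as a list of
   (position, tile type) pairs (compared as sets, see [same_set]). *)
Definition supertile := list (pos * tile).

Definition dom (A : supertile) : list pos := map fst A.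

Definition adjacent (p q : pos) : Prop :=
  (Z.abs (fst p - fst q) + Z.abs (snd p - snd q) = 1)%Z.

Definition edge_connected (A : supertile) : Prop :=
  forall p q, In p (dom A) -> In q (dom A) ->
    Relation_Operators.clos_refl_trans pos
      (fun x y => In x (dom A) /\ In y (dom A) /\ adjacent x y) p q.

Definition is_supertile (A : supertile) : Prop :=
  A <> [] /\ NoDup (dom A) /\ edge_connected A.

Definition shift (v : pos) (A : supertile) : supertile :=
  map (fun pt => ((fst (fst pt) + fst v, snd (fst pt) + snd v)%Z, snd pt)) A.

Definition same_set (A B : supertile) : Prop := forall x, In x A <-> In x B.

Definition translate_eq (A B : supertile) : Prop :=
  exists v, same_set (shift v A) B.

Definition bond (G : glue_fn) (a b : pos * tile) : nat :=
  let '((px, py), t) := a in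
  let '((qx, qy), u) := b in
  if (Z.eqb qx (px + 1) && Z.eqb qy py)%bool then G (gE t) (gW u)
  else if (Z.eqb qx (px - 1) && Z.eqb qy py)%bool then G (gW t) (gE u)
  else if (Z.eqb qx px && Z.eqb qy (py + 1))%bool then G (gN t) (gS u)
  else if (Z.eqb qx px && Z.eqb qy (py - 1))%bool then G (gS t) (gN u)
  else 0%nat.

Definition strength (G : glue_fn) (A B : supertile) : nat :=
  list_sum (map (fun a => list_sum (map (fun b => bond G a b) B)) A).

Definition combinable (tau : nat) (G : glue_fn) (A B : supertile) : Prop :=
  (forall p, In p (dom A) -> ~ In p (dom B)) /\ (tau <= strength G A B)%nat.

Inductive produced (tau : nat) (G : glue_fn) (init : supertile -> Prop)
  : supertile -> Prop :=
| prod_init : forall A v, init A -> produced tau G init (shift v A)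
| prod_comb : forall A B, produced tau G init A -> produced tau G init B ->
    combinable tau G A B -> produced tau G init (A ++ B).

Definition terminal (tau : nat) (G : glue_fn) (init : supertile -> Prop)
  (A : supertile) : Prop :=
  produced tau G init A /\
  forall B, produced tau G init B -> ~ combinable tau G A B.

Definition fully_connected (G : glue_fn) (A : supertile) : Prop :=
  forall a b, In a A -> In b A -> adjacent (fst a) (fst b) -> (0 < bond G a b)%nat.

(* A bin: the indices of the bins of the previous stage whose terminal
   supertiles are poured in, plus additional tile types. *)
Record bin := Bin { bin_from : list nat; bin_tiles : list tile }.

Record system := System {
  sys_temp : nat;
  sys_glue : glue_fn;
  sys_stages : list (list bin);
  sys_output : list nat           (* selected bins of the last stage *)
}.

Definition single (t : tile) : supertile := [((0%Z, 0%Z), t)].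

Definition bin_init (prev : nat -> supertile -> Prop) (b : bin)
  : supertile -> Prop :=
  fun A => (exists j, In j (bin_from b) /\ prev j A) \/
           (exists t, In t (bin_tiles b) /\ A = single t).

Definition bin_terminal (tau : nat) (G : glue_fn)
  (prev : nat -> supertile -> Prop) (b : bin) : supertile -> Prop :=
  terminal tau G (bin_init prev b).

Definition stage_terminal (tau : nat) (G : glue_fn)
  (prev : nat -> supertile -> Prop) (st : list bin) : nat -> supertile -> Prop :=
  fun j A => exists b, nth_error st j = Some b /\ bin_terminal tau G prev b A.

Definition no_bins : nat -> supertile -> Prop := fun _ _ => False.

Fixpoint final_terminal (tau : nat) (G : glue_fn)
  (prev : nat -> supertile -> Prop) (stages : list (list bin))
  : nat -> supertile -> Prop :=
  match stages with
  | [] => prev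
  | st :: rest => final_terminal tau G (stage_terminal tau G prev st) rest
  end.

Fixpoint bins_unique (tau : nat) (G : glue_fn)
  (prev : nat -> supertile -> Prop) (stages : list (list bin)) : Prop :=
  match stages with
  | [] => True
  | st :: rest =>
      (forall b, In b st -> exists A, bin_terminal tau G prev b A /\
         forall B, bin_terminal tau G prev b B -> translate_eq A B) /\
      bins_unique tau G (stage_terminal tau G prev st) rest
  end.

Fixpoint stages_wf (prev_len : option nat) (stages : list (list bin)) : Prop :=
  match stages with
  | [] => True
  | st :: rest =>
      (forall b, In b st -> forall j, In j (bin_from b) ->
         match prev_len with None => False | Some l => (j < l)%nat end) /\
      stages_wf (Some (length st)) rest
  end.

Definition system_wf (S : system) : Prop :=
  0 < sys_temp S /\ valid_glue_fn (sys_temp S) (sys_glue S) /\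
  sys_stages S <> [] /\
  stages_wf None (sys_stages S) /\
  (forall j, In j (sys_output S) ->
     (j < length (last (sys_stages S) []))%nat).

Definition uniquely_assembles (S : system) (P : supertile) : Prop :=
  let T := final_terminal (sys_temp S) (sys_glue S) no_bins (sys_stages S) in
  bins_unique (sys_temp S) (sys_glue S) no_bins (sys_stages S) /\
  (exists j, In j (sys_output S) /\ T j P) /\
  (forall j A, In j (sys_output S) -> T j A -> translate_eq A P).

Definition has_square_shape (n : nat) (P : supertile) : Prop :=
  exists v : pos, forall p : pos, In p (dom P) <->
    ((fst v <= fst p < fst v + Z.of_nat n) /\
     (snd v <= snd p < snd v + Z.of_nat n))%Z.

Definition stage_complexity (S : system) : nat := length (sys_stages S).

Definition bin_complexity (S : system) : nat :=
  list_max (map (@length bin) (sys_stages S)).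

Definition tiles_used (S : system) : list tile :=
  flat_map (fun st => flat_map bin_tiles st) (sys_stages S).

Definition tile_complexity (S : system) : nat :=
  length (nodup tile_eq_dec (tiles_used S)).

Definition glue_complexity (S : system) : nat :=
  length (nodup Nat.eq_dec
    (filter (fun g => negb (Nat.eqb g null_glue))
       (flat_map (fun t => [gN t; gE t; gS t; gW t]) (tiles_used S)))).

(* Main.v *)
(** Glues 1, 2, 3 bind with strength 2 and only to themselves; glue 4 binds to itself
    with strength 1.  A row whose west end is labelled [l] and whose east end is labelled
    [m] joins a row with ends [m], [r] in a single way when [l], [m], [r] are distinct, and
    the result is inert.  The rows with ends (1,2), (2,3), (3,1) thus give rows of twice the
    length with ends (1,3), (2,1), (3,2), and symmetrically back, so three bins suffice to
    double a row or to lengthen it by one tile; three more do the same for columns.  After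
    logarithmically many stages a row, a corner tile and a column form an L-shaped frame
    whose inner sides carry glue 4.  A filler tile with glue 4 on all sides attaches only
    where it finds both a western and a southern neighbour, so it fills exactly the square,
    with every interior edge bonded. *)

Require Import Defs.
From Stdlib Require Import ZArith List Arith.
From Stdlib Require Import Lia.
Import ListNotations.
(* [ZArith] and [List] shadow some names of [Defs], such as [shift]. *)
Import Defs.

Open Scope Z_scope.

(** * The glue function *)

Definition Gl : glue_fn := fun a b =>
  if Nat.eqb a b then
    match a with 1%nat | 2%nat | 3%nat => 2%nat | 4%nat => 1%nat | _ => 0%nat end
  else 0%nat.

Lemma Gl_valid : valid_glue_fn 2 Gl.
Proof.
  unfold valid_glue_fn, Gl, null_glue; repeat split; intros.
  - rewrite (Nat.eqb_sym y x). destruct (Nat.eqb_spec x y); subst; reflexivity.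
  - destruct (Nat.eqb 0 x); reflexivity.
  - destruct (Nat.eqb x y); [destruct x as [|[|[|[|[|x]]]]]|]; lia.
Qed.

Lemma Gl_pos a b : (0 < Gl a b)%nat -> a = b /\ a <> 0%nat.
Proof.
  unfold Gl. destruct (Nat.eqb_spec a b); [|lia].
  intros H; split; [assumption|]. intros ->. lia.
Qed.

Lemma Gl_sym a b : Gl a b = Gl b a.
Proof. apply Gl_valid. Qed.

Lemma Gl_4_le a : (Gl a 4 <= 1)%nat.
Proof. unfold Gl. destruct (Nat.eqb_spec a 4); subst; lia. Qed.

Definition padd (p q : pos) : pos := (fst p + fst q, snd p + snd q).
Definition psub (p q : pos) : pos := (fst p - fst q, snd p - snd q).

Ltac psimp := unfold padd, psub in *; cbn [fst snd] in *.
Ltac plia := psimp; f_equal; lia.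

(** * Bonds and strength *)

Lemma bond_sym a b : bond Gl a b = bond Gl b a.
Proof.
  destruct a as [[px py] t], b as [[qx qy] u]; unfold bond.
  assert (H : forall i j, (i =? j + 1) = (j =? i - 1))
    by (intros i j; destruct (Z.eqb_spec i (j + 1)), (Z.eqb_spec j (i - 1)); lia).
  rewrite !H, (Z.eqb_sym px qx), (Z.eqb_sym py qy).
  destruct (Z.eqb_spec px (qx - 1)), (Z.eqb_spec qy py), (Z.eqb_spec qx (px - 1)),
    (Z.eqb_spec qx px), (Z.eqb_spec py (qy - 1)), (Z.eqb_spec qy (py - 1));
    cbn [andb]; auto using Gl_sym; lia.
Qed.

Lemma bond_east x y t u :
  bond Gl ((x, y), t) ((x + 1, y), u) = Gl (gE t) (gW u).
Proof. unfold bond. rewrite !Z.eqb_refl. reflexivity. Qed.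

Lemma bond_north x y t u :
  bond Gl ((x, y), t) ((x, y + 1), u) = Gl (gN t) (gS u).
Proof.
  unfold bond. rewrite !Z.eqb_refl.
  destruct (Z.eqb_spec x (x + 1)), (Z.eqb_spec x (x - 1)); try lia. reflexivity.
Qed.

(* [touch a b]: [b] is bonded to the east or north side of [a]. *)
Inductive touch : pos * tile -> pos * tile -> Prop :=
| touch_east x y t u : (0 < Gl (gE t) (gW u))%nat -> touch ((x, y), t) ((x + 1, y), u)
| touch_north x y t u : (0 < Gl (gN t) (gS u))%nat -> touch ((x, y), t) ((x, y + 1), u).

Lemma bond_pos a b : (0 < bond Gl a b)%nat -> touch a b \/ touch b a.
Proof.
  intros H. destruct a as [[px py] t], b as [[qx qy] u].
  pose proof H as H'. unfold bond in H'.
  destruct (Z.eqb_spec qx (px + 1)), (Z.eqb_spec qy py), (Z.eqb_spec qx (px - 1)),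
    (Z.eqb_spec qx px), (Z.eqb_spec qy (py + 1)), (Z.eqb_spec qy (py - 1));
    try lia; cbn [andb] in H'; subst; try lia.
  - left. now constructor.
  (* Writing the coordinate as [px - 1 + 1] gives the goal the form of [touch_east]; likewise to the
     north below. *)
  - right. rewrite <- (Z.sub_add 1 px) at 2. constructor. now rewrite Gl_sym.
  - left. now constructor.
  - right. rewrite <- (Z.sub_add 1 py) at 2. constructor. now rewrite Gl_sym.
Qed.

Lemma list_sum_map_cons {T} (f : T -> nat) a l :
  list_sum (map f (a :: l)) = (f a + list_sum (map f l))%nat.
Proof. reflexivity. Qed.

Lemma list_sum_pos {T} (f : T -> nat) l :
  (0 < list_sum (map f l))%nat -> exists a, In a l /\ (0 < f a)%nat.
Proof.
  induction l as [|a l IH]; [cbn; lia|]. rewrite list_sum_map_cons. intros H.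
  destruct (f a) eqn:E.
  - destruct (IH H) as (b & Hb & Hf). exists b. split; [now right|exact Hf].
  - exists a. split; [now left|lia].
Qed.

Lemma list_sum_ge {T} (f : T -> nat) l a :
  In a l -> (f a <= list_sum (map f l))%nat.
Proof.
  induction l as [|b l IH]; [intros []|]. rewrite list_sum_map_cons.
  intros [->|H]; [lia|]. specialize (IH H). lia.
Qed.

Lemma list_sum_ge2 {T} (f : T -> nat) l a b :
  In a l -> In b l -> a <> b -> (f a + f b <= list_sum (map f l))%nat.
Proof.
  induction l as [|c l IH]; [intros []|]. rewrite list_sum_map_cons.
  intros [->|Ha] [->|Hb] N.
  - congruence.
  - pose proof (list_sum_ge f l b Hb). lia.
  - pose proof (list_sum_ge f l a Ha). lia.
  - specialize (IH Ha Hb N). lia.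
Qed.

(** This is cooperative binding: contributions of at most 1 reach temperature 2 only if two distinct
    cells contribute. *)
Lemma list_sum_two (f : pos * tile -> nat) l :
  NoDup (map fst l) -> (forall a, In a l -> (f a <= 1)%nat) ->
  (2 <= list_sum (map f l))%nat ->
  exists a b, In a l /\ In b l /\ fst a <> fst b /\ (0 < f a)%nat /\ (0 < f b)%nat.
Proof.
  induction l as [|a l IH]; [cbn; lia|]. rewrite list_sum_map_cons. intros ND Hle H.
  inversion ND as [|? ? Hnin ND']; subst.
  destruct (f a) eqn:E.
  - destruct IH as (b & c & ? & ? & ? & ? & ?); auto with datatypes.
    exists b, c; auto with datatypes.
  - pose proof (Hle a (or_introl eq_refl)).
    destruct (list_sum_pos f l) as (b & Hb & Hf); [lia|].
    exists a, b. repeat split; auto with datatypes; [|lia].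
    intros e. apply Hnin. rewrite e. now apply in_map.
Qed.

Lemma strength_pos A B : (0 < strength Gl A B)%nat ->
  exists a b, In a A /\ In b B /\ (touch a b \/ touch b a).
Proof.
  intros H. unfold strength in H.
  destruct (list_sum_pos _ _ H) as (a & Ha & H1).
  destruct (list_sum_pos _ _ H1) as (b & Hb & H2).
  exists a, b. auto using bond_pos.
Qed.

Lemma strength_ge A B a b : In a A -> In b B -> (bond Gl a b <= strength Gl A B)%nat.
Proof.
  intros Ha Hb. unfold strength.
  eapply Nat.le_trans; [|apply (list_sum_ge _ A a Ha)].
  cbn beta. exact (list_sum_ge (fun b => bond Gl a b) B b Hb).
Qed.

Lemma list_sum_add {T} (f g : T -> nat) l :
  list_sum (map (fun a => f a + g a)%nat l) = (list_sum (map f l) + list_sum (map g l))%nat.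
Proof. induction l as [|a l IH]; [reflexivity|]. rewrite !list_sum_map_cons. lia. Qed.

Lemma list_sum_0 {T} (l : list T) : list_sum (map (fun _ => 0%nat) l) = 0%nat.
Proof. induction l; auto. Qed.

Lemma strength_sym A B : strength Gl A B = strength Gl B A.
Proof.
  unfold strength. revert B. induction A as [|a A IH]; intros B.
  - symmetry. apply list_sum_0.
  - rewrite list_sum_map_cons, IH.
    transitivity (list_sum
      (map (fun b => bond Gl b a + list_sum (map (bond Gl b) A))%nat B)); [|reflexivity].
    rewrite list_sum_add. f_equal. f_equal. apply map_ext. intros b. apply bond_sym.
Qed.

Lemma combinable_sym A B : combinable 2 Gl A B -> combinable 2 Gl B A.
Proof.
  intros [H1 H2]; split; [firstorder|]. now rewrite strength_sym.
Qed.

Lemma combinable_touch A B : combinable 2 Gl A B ->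
  exists a b, In a A /\ In b B /\ (touch a b \/ touch b a).
Proof. intros [_ H]. apply strength_pos. lia. Qed.

(** * Occupied cells and translations *)

Lemma in_dom p t A : In (p, t) A -> In p (dom A).
Proof. intros H. exact (in_map fst _ _ H). Qed.

Lemma dom_in p A : In p (dom A) -> exists t, In (p, t) A.
Proof.
  intros H. apply in_map_iff in H. destruct H as ([q t] & <- & H). eauto.
Qed.

Lemma in_shift v A p t : In (p, t) (shift v A) <-> In (psub p v, t) A.
Proof.
  unfold shift. rewrite in_map_iff. split.
  - intros ([[x y] u] & E & H). inversion E; subst. psimp.
    replace (x + fst v - fst v, y + snd v - snd v) with (x, y) by (f_equal; lia). exact H.
  - intros H. exists (psub p v, t). split; [|exact H].
    psimp. destruct p; cbn. repeat f_equal; lia.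
Qed.

Lemma NoDup_dom_shift v A : NoDup (dom A) -> NoDup (dom (shift v A)).
Proof.
  intros H.
  replace (dom (shift v A)) with (map (fun p => padd p v) (dom A)).
  - apply NoDup_map_NoDup_ForallPairs; [|exact H].
    intros [a b] [c d] _ _ E. psimp. inversion E. f_equal; lia.
  - unfold dom, shift. rewrite !map_map. reflexivity.
Qed.

(** * Supertiles known up to translation *)

(** Patterns are relations rather than lists, so the order in which tiles were attached is
    forgotten; [v] is the place of the origin of [R]. *)
Definition shape_at (R : pos -> tile -> Prop) (v : pos) (A : supertile) : Prop :=
  NoDup (dom A) /\ forall p t, In (p, t) A <-> R (psub p v) t.

Definition shape R A := exists v, shape_at R v A.

Lemma shape_at_shift R v w A : shape_at R v A -> shape_at R (padd v w) (shift w A).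
Proof.
  intros [H1 H2]; split; [now apply NoDup_dom_shift|].
  intros p t. rewrite in_shift, H2.
  replace (psub (psub p w) v) with (psub p (padd v w)) by plia. reflexivity.
Qed.

Lemma shape_shift R w A : shape R A -> shape R (shift w A).
Proof. intros [v H]. exists (padd v w). now apply shape_at_shift. Qed.

Lemma shape_at_move R v w A : shape_at R v A -> shape_at R w (shift (psub w v) A).
Proof.
  intros H. apply (shape_at_shift _ _ (psub w v)) in H.
  replace (padd v (psub w v)) with w in H by (destruct w; plia). exact H.
Qed.

Lemma shape_rigid R A B : shape R A -> shape R B -> translate_eq A B.
Proof.
  intros [v HA] [w [_ HB]]. exists (psub w v).
  apply (shape_at_move _ _ w) in HA. destruct HA as [_ HA].
  intros [p t]. now rewrite HA, HB.
Qed.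

Lemma dom_app A B : dom (A ++ B) = dom A ++ dom B.
Proof. apply map_app. Qed.

Lemma NoDup_dom_app A B : NoDup (dom A) -> NoDup (dom B) ->
  (forall p, In p (dom A) -> ~ In p (dom B)) -> NoDup (dom (A ++ B)).
Proof. intros. rewrite dom_app. now apply NoDup_app. Qed.

(** Both orders of appending are covered, since production may combine the two parts in either
    order. *)
Lemma shape_at_app RA RB RC w v A B :
  (forall q t, RC q t <-> RA q t \/ RB (psub q w) t) ->
  shape_at RA v A -> shape_at RB (padd v w) B ->
  (forall p, In p (dom A) -> ~ In p (dom B)) ->
  shape_at RC v (A ++ B) /\ shape_at RC v (B ++ A).
Proof.
  intros HR [NA HA] [NB HB] D.
  assert (E : forall p, psub p (padd v w) = psub (psub p v) w) by (intros; plia).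
  split; split.
  - now apply NoDup_dom_app.
  - intros p t. now rewrite in_app_iff, HA, HB, HR, E.
  - apply NoDup_dom_app; firstorder.
  - intros p t. rewrite in_app_iff, HA, HB, HR, E. tauto.
Qed.

Definition yields (T : supertile -> Prop) (R : pos -> tile -> Prop) : Prop :=
  (exists A, T A) /\ forall A, T A -> shape R A.

Lemma yields_inv T R : yields T R -> exists A, T A /\ shape R A.
Proof. intros [[A HA] H]. eauto. Qed.

(** If no two translates of [R] stick together, nothing is ever combined, so every produced
    supertile is a translate of [R] and terminal. *)
Lemma terminal_single R init :
  yields init R ->
  (forall A B, shape R A -> shape R B -> ~ combinable 2 Gl A B) ->
  yields (terminal 2 Gl init) R.
Proof.
  intros Hi Hn.
  assert (P : forall A, produced 2 Gl init A -> shape R A).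
  { induction 1 as [A v H|A B _ IA _ IB C].
    - apply shape_shift. now apply Hi.
    - destruct (Hn A B IA IB C). }
  split.
  - destruct Hi as [[A HA] Hi].
    exists (shift (0, 0) A). split; [now constructor|].
    intros B HB. apply Hn; [apply shape_shift; auto|auto].
  - intros A [HA _]. auto.
Qed.

(** A bin with two reactants that fit in one relative position [w] only and whose product is inert.
    Just three shapes are ever produced, and a reactant is never terminal because a suitable
    translate of its partner is also produced. *)
Lemma terminal_merge RA RB RC w (init : supertile -> Prop) :
  (forall A, init A -> shape RA A \/ shape RB A) ->
  (exists A, init A /\ shape RA A) -> (exists B, init B /\ shape RB B) ->
  (forall q t, RC q t <-> RA q t \/ RB (psub q w) t) ->
  (forall v A B, shape_at RA v A -> shape_at RB (padd v w) B -> combinable 2 Gl A B) ->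
  (forall v u A B, shape_at RA v A -> shape_at RB u B -> combinable 2 Gl A B -> u = padd v w) ->
  (forall A B, shape RA A -> shape RA B -> ~ combinable 2 Gl A B) ->
  (forall A B, shape RB A -> shape RB B -> ~ combinable 2 Gl A B) ->
  (forall A B, shape RC A -> shape RA B -> ~ combinable 2 Gl A B) ->
  (forall A B, shape RC A -> shape RB B -> ~ combinable 2 Gl A B) ->
  (forall A B, shape RC A -> shape RC B -> ~ combinable 2 Gl A B) ->
  yields (terminal 2 Gl init) RC.
Proof.
  intros Hi (A0 & iA & sA) (B0 & iB & sB) HR Hcan Honly NAA NBB NCA NCB NCC.
  assert (P : forall A, produced 2 Gl init A -> shape RA A \/ shape RB A \/ shape RC A).
  { induction 1 as [A v H|A B _ IA _ IB C].
    - destruct (Hi A H); auto using shape_shift.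
    - pose proof (combinable_sym _ _ C) as C'.
      (* Of the nine pairs only the two orders of a reactant with its partner survive the hypotheses
         of non-combination. *)
      destruct IA as [IA|[IA|IA]], IB as [IB|[IB|IB]];
        try solve [ exfalso; first [ exact (NAA _ _ IA IB C) | exact (NBB _ _ IA IB C)
          | exact (NCC _ _ IA IB C) | exact (NCA _ _ IA IB C) | exact (NCA _ _ IB IA C')
          | exact (NCB _ _ IA IB C) | exact (NCB _ _ IB IA C') ] ].
      + right; right. destruct IA as [v IA], IB as [u IB].
        rewrite (Honly v u A B IA IB C) in IB.
        exists v. apply (shape_at_app RA RB RC w v A B HR IA IB), C.
      + right; right. destruct IA as [v IA], IB as [u IB].
        rewrite (Honly u v B A IB IA C') in IA.
        exists u. apply (shape_at_app RA RB RC w u B A HR IB IA), C'. }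
  assert (PC : forall A, produced 2 Gl init A -> shape RC A -> terminal 2 Gl init A).
  { intros A HA sC. split; [exact HA|]. intros B HB.
    destruct (P B HB) as [?|[?|?]]; eauto. }
  destruct sA as [va sA], sB as [vb sB].
  split.
  - exists (shift (psub (0,0) va) A0 ++ shift (psub (padd (0,0) w) vb) B0).
    apply (shape_at_move _ _ (0,0)) in sA. apply (shape_at_move _ _ (padd (0,0) w)) in sB.
    pose proof (Hcan _ _ _ sA sB) as C.
    apply PC.
    + apply prod_comb; auto; now constructor.
    + exists (0,0). apply (shape_at_app RA RB RC w _ _ _ HR sA sB), C.
  - intros A [HA HT]. destruct (P A HA) as [[v S]|[[v S]|S]]; [exfalso|exfalso|exact S].
    (* The partner is moved to offset [w] from this reactant, where it can attach. *)
    + apply (HT (shift (psub (padd v w) vb) B0)); [now constructor|].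
      apply (Hcan v); [exact S|]. now apply shape_at_move.
    + apply (HT (shift (psub (psub v w) va) A0)); [now constructor|].
      apply combinable_sym. apply (Hcan (psub v w)); [now apply shape_at_move|].
      replace (padd (psub v w) w) with v by (destruct v; plia). exact S.
Qed.

(** * Lines *)

(* [d = false] is a horizontal row growing east, [d = true] a column growing north. *)
Definition along (d : bool) (q : pos) : Z := if d then snd q else fst q.
Definition across (d : bool) (q : pos) : Z := if d then fst q else snd q.
Definition vec (d : bool) (k : Z) : pos := if d then (0, k) else (k, 0).
Definition tstart (d : bool) (t : tile) : glue := if d then gS t else gW t.
Definition tend (d : bool) (t : tile) : glue := if d then gN t else gE t.
(** The long sides of a line: [tback] faces the outside of the square to be built, [tfront] its
    interior. *)
Definition tback (d : bool) (t : tile) : glue := if d then gW t else gS t.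
Definition tfront (d : bool) (t : tile) : glue := if d then gE t else gN t.

Definition line (d : bool) (k : Z) (f : Z -> tile) (q : pos) (t : tile) : Prop :=
  0 <= along d q < k /\ across d q = 0 /\ t = f (along d q).

(** Null glue along the back rules out lateral contact of parallel or crossing lines, so only the
    end labels matter for how lines combine. *)
Record wline (d : bool) (k : Z) (f : Z -> tile) (l r : glue) : Prop := {
  wl_pos : 0 < k;
  wl_back : forall i, 0 <= i < k -> tback d (f i) = 0%nat;
  wl_start : tstart d (f 0) = l;
  wl_end : tend d (f (k - 1)) = r }.

Lemma line_in_dom d k f v A p : shape_at (line d k f) v A ->
  0 <= along d (psub p v) < k -> across d (psub p v) = 0 -> In p (dom A).
Proof.
  intros [_ H] H1 H2. apply (in_dom p (f (along d (psub p v)))).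
  apply H. red; auto.
Qed.

(** Lateral contact would use a null back glue, and contact at any other pair of tiles than the last
    of [A] and the first of [B] would make the lines overlap. *)
Lemma line_touch d k f l r k' f' l' r' v v' A B a b :
  wline d k f l r -> wline d k' f' l' r' ->
  shape_at (line d k f) v A -> shape_at (line d k' f') v' B ->
  (forall p, In p (dom A) -> ~ In p (dom B)) ->
  In a A -> In b B -> touch a b ->
  r = l' /\ r <> 0%nat /\ v' = padd v (vec d k).
Proof.
  intros W W' HA HB D Ia Ib T.
  destruct W as [kp bk st en], W' as [kp' bk' st' en'].
  assert (LA := fun p => line_in_dom d k f v A p HA).
  assert (LB := fun p => line_in_dom d k' f' v' B p HB).
  destruct HA as [_ HA], HB as [_ HB].
  destruct v as [vx vy], v' as [wx wy].
  destruct T as [x y t u Hg|x y t u Hg]; apply HA in Ia; apply HB in Ib;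
    destruct Ia as (a1 & a2 & ->), Ib as (b1 & b2 & ->);
    apply Gl_pos in Hg; destruct Hg as [e ne];
    specialize (bk' _ b1);
    destruct d; cbn in *;
    try congruence.
  (* Otherwise the cell [(x + 1, y)] of [B] would also belong to [A]. *)
  - assert (x - vx = k - 1).
    { destruct (Z.eq_dec (x - vx) (k - 1)); auto. exfalso.
      apply (D (x + 1, y)); [apply LA; cbn; lia|apply LB; cbn; lia]. }
    (* Otherwise the cell [(x, y)] of [A] would also belong to [B]. *)
    assert (x + 1 - wx = 0).
    { destruct (Z.eq_dec (x + 1 - wx) 0); auto. exfalso.
      apply (D (x, y)); [apply LA; cbn; lia|apply LB; cbn; lia]. }
    repeat split; [congruence|congruence|unfold padd; cbn; f_equal; lia].
  - assert (y - vy = k - 1).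
    { destruct (Z.eq_dec (y - vy) (k - 1)); auto. exfalso.
      apply (D (x, y + 1)); [apply LA; cbn; lia|apply LB; cbn; lia]. }
    assert (y + 1 - wy = 0).
    { destruct (Z.eq_dec (y + 1 - wy) 0); auto. exfalso.
      apply (D (x, y)); [apply LA; cbn; lia|apply LB; cbn; lia]. }
    repeat split; [congruence|congruence|unfold padd; cbn; f_equal; lia].
Qed.

(** The second case records no position: its equation of labels is refuted wherever the lemma is
    applied. *)
Lemma line_combinable d k f l r k' f' l' r' v v' A B :
  wline d k f l r -> wline d k' f' l' r' ->
  shape_at (line d k f) v A -> shape_at (line d k' f') v' B ->
  combinable 2 Gl A B ->
  (r = l' /\ r <> 0%nat /\ v' = padd v (vec d k)) \/ (r' = l /\ r' <> 0%nat).
Proof.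
  intros W W' HA HB C.
  destruct (combinable_touch _ _ C) as (a & b & Ia & Ib & [T|T]).
  - left. eapply (line_touch d k f l r k' f' l' r'); eauto. apply C.
  - right. apply combinable_sym in C.
    destruct (line_touch d k' f' l' r' k f l r v' v B A b a) as (?&?&?); auto. apply C.
Qed.

Lemma line_not_combinable d k f l r k' f' l' r' A B :
  wline d k f l r -> wline d k' f' l' r' ->
  r <> l' -> r' <> l ->
  shape (line d k f) A -> shape (line d k' f') B -> ~ combinable 2 Gl A B.
Proof.
  intros W W' N N' [v HA] [v' HB] C.
  destruct (line_combinable d k f l r k' f' l' r' v v' A B) as [(?&_)|(?&_)]; auto.
Qed.

Definition fcat (k : Z) (f g : Z -> tile) (i : Z) : tile :=
  if i <? k then f i else g (i - k).

Lemma wline_cat d k f l m k' f' m' r :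
  wline d k f l m -> wline d k' f' m' r -> wline d (k + k') (fcat k f f') l r.
Proof.
  intros [kp bk st en] [kp' bk' st' en']. unfold fcat. constructor; [lia| | |].
  - intros i Hi. destruct (Z.ltb_spec i k); [apply bk; lia|apply bk'; lia].
  - destruct (Z.ltb_spec 0 k); [auto|lia].
  - destruct (Z.ltb_spec (k + k' - 1) k); [lia|].
    replace (k + k' - 1 - k) with (k' - 1) by lia. auto.
Qed.

Lemma line_cat d k f k' f' q t : 0 < k -> 0 < k' ->
  line d (k + k') (fcat k f f') q t <->
  line d k f q t \/ line d k' f' (psub q (vec d k)) t.
Proof.
  intros H H'. unfold line, fcat. destruct q as [x y].
  destruct d; cbn [along across vec psub fst snd]; rewrite ?Z.sub_0_r;
  match goal with |- context [?i <? k] => destruct (Z.ltb_spec i k) end;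
  intuition lia.
Qed.

(** With [l], [m], [r] distinct, the only ends that match are the two labelled [m]; the product
    shows [l] and [r] in roles in which no partner in the bin answers them. *)
Lemma terminal_line_merge d k f l m k' f' r (init : supertile -> Prop) :
  wline d k f l m -> wline d k' f' m r ->
  Gl m m = 2%nat -> l <> m -> m <> r -> l <> r ->
  (forall A, init A -> shape (line d k f) A \/ shape (line d k' f') A) ->
  (exists A, init A /\ shape (line d k f) A) ->
  (exists B, init B /\ shape (line d k' f') B) ->
  yields (terminal 2 Gl init) (line d (k + k') (fcat k f f')).
Proof.
  intros W W' G2 lm mr lr Hi HA HB.
  pose proof (wline_cat _ _ _ _ _ _ _ _ _ W W') as W2.
  pose proof (wl_pos _ _ _ _ _ W) as kp. pose proof (wl_pos _ _ _ _ _ W') as kp'.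
  apply (terminal_merge (line d k f) (line d k' f') _ (vec d k)); auto.
  - intros. now apply line_cat.
  - intros [vx vy] A B [_ sA] [_ sB]. split.
    + intros p pA pB. apply dom_in in pA, pB. destruct pA as [t pA], pB as [u pB].
      apply sA in pA. apply sB in pB. destruct pA as (a1&a2&_), pB as (b1&b2&_).
      destruct d; cbn in *; lia.
    (* The temperature 2 is the value of the two facing glues [m], so this single bond suffices. *)
    + rewrite <- G2, <- (wl_end _ _ _ _ _ W) at 1. rewrite <- (wl_start _ _ _ _ _ W').
      destruct d; cbn [tend tstart].
      * rewrite <- (bond_north vx (vy + (k - 1))).
        apply strength_ge; [apply sA|apply sB]; repeat split; cbn; try lia;
          f_equal; lia.
      * rewrite <- (bond_east (vx + (k - 1)) vy).
        apply strength_ge; [apply sA|apply sB]; repeat split; cbn; try lia;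
          f_equal; lia.
  - intros v u A B sA sB C.
    destruct (line_combinable d k f l m k' f' m r v u A B) as [(?&?&?)|(?&?)]; auto.
    congruence.
  - intros A B. apply (line_not_combinable d k f l m k f l m); auto.
  - intros A B. apply (line_not_combinable d k' f' m r k' f' m r); auto.
  - intros A B. eapply line_not_combinable; eauto.
  - intros A B. eapply line_not_combinable; eauto.
  - intros A B. eapply line_not_combinable; eauto.
Qed.

(** * Sealed supertiles *)

(* The west and south sides of a sealed supertile offer no glue, and two sealed supertiles
   could only meet along such a side of one of them. *)
Definition sealed (A : supertile) : Prop :=
  forall x y t, In ((x, y), t) A ->
    (gS t = 0%nat \/ In (x, y - 1) (dom A)) /\ (gW t = 0%nat \/ In (x - 1, y) (dom A)).

Lemma sealed_touch A a b : sealed A -> In b A -> touch a b -> In (fst a) (dom A).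
Proof.
  intros S Ib T. destruct T as [x y t u Hg|x y t u Hg]; apply Gl_pos in Hg;
    destruct (S _ _ _ Ib) as [[?|HS] [?|HW]]; cbn [fst];
    rewrite ?Z.add_simpl_r in *; auto; destruct Hg; congruence.
Qed.

Lemma sealed_not_combinable A B : sealed A -> sealed B -> ~ combinable 2 Gl A B.
Proof.
  intros SA SB C. pose proof (proj1 C) as D.
  destruct (combinable_touch _ _ C) as ([p t] & [q u] & Ia & Ib & [T|T]).
  - apply (D p); [eapply in_dom; eauto|]. exact (sealed_touch _ _ _ SB Ib T).
  - apply (D q); [|eapply in_dom; eauto]. exact (sealed_touch _ _ _ SA Ia T).
Qed.

(** A sealed supertile can only be left through its north or east sides; the west sides of the
    column are null, so its foot must stand on a tile of [A]. *)
Lemma column_on_sealed k f l r v A B :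
  wline true k f l r -> shape_at (line true k f) v B -> sealed A ->
  combinable 2 Gl A B ->
  exists x y t, In ((x, y), t) A /\ v = (x, y + 1) /\ gN t = l.
Proof.
  intros W sB SA C. pose proof (proj1 C) as D.
  destruct (combinable_touch _ _ C) as ([p t] & [q u] & Ia & Ib & [T|T]).
  - assert (LB := fun p => line_in_dom _ _ _ _ _ p sB).
    destruct sB as [_ sB], W as [kp bk st _], v as [vx vy].
    inversion T as [x y ? ? Hg|x y ? ? Hg]; subst; clear T;
      apply sB in Ib; destruct Ib as (b1 & b2 & ->); cbn in *;
      apply Gl_pos in Hg; destruct Hg as [e ne].
    + rewrite (bk _ b1) in e. congruence.
    + assert (y + 1 - vy = 0) as E.
      { destruct (Z.eq_dec (y + 1 - vy) 0); auto. exfalso.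
        apply (D (x, y)); [eapply in_dom; eauto|apply LB; cbn; lia]. }
      exists x, y, t. repeat split; [exact Ia|f_equal; lia|]. now rewrite e, E.
  - destruct (D q); [|eapply in_dom; eauto]. exact (sealed_touch _ _ _ SA Ia T).
Qed.

(** What the finished square needs beyond [wline]: glue 4 towards the fillers and bonds inside the
    line. It is kept apart because the corner tile, with north glue 1, satisfies [wline] only. *)
Record chain (d : bool) (k : Z) (f : Z -> tile) (l r : glue) : Prop := {
  ch_line : wline d k f l r;
  ch_front : forall i, 0 <= i < k -> tfront d (f i) = 4%nat;
  ch_link : forall i, 0 <= i < k - 1 -> (0 < Gl (tend d (f i)) (tstart d (f (i + 1)%Z)))%nat }.

Lemma chain_cat d k f l k' f' m r :
  chain d k f l m -> chain d k' f' m r -> (0 < Gl m m)%nat ->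
  chain d (k + k') (fcat k f f') l r.
Proof.
  intros [W F L] [W' F' L'] Hm. constructor.
  - eapply wline_cat; eauto.
  - intros i Hi. unfold fcat. destruct (Z.ltb_spec i k); [apply F|apply F']; lia.
  - intros i Hi. unfold fcat.
    destruct (Z.ltb_spec i k), (Z.ltb_spec (i + 1) k); try lia.
    + apply L; lia.
    + assert (i = k - 1) as -> by lia.
      rewrite (wl_end _ _ _ _ _ W), Z.sub_add, Z.sub_diag, (wl_start _ _ _ _ _ W'). exact Hm.
    + replace (i + 1 - k) with (i - k + 1) by lia. apply L'; lia.
Qed.

Lemma line_single d t : shape (line d 1 (fun _ => t)) (single t).
Proof.
  exists (0, 0). split.
  - repeat constructor; auto.
  - intros [x y] u. unfold line, single. psimp. rewrite !Z.sub_0_r. split.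
    + intros [E|[]]. inversion E; subst. destruct d; cbn; auto with zarith.
    + intros (H1 & H2 & ->). left. destruct d; cbn in *; repeat f_equal; lia.
Qed.

(** * Contents and results of a bin *)

Lemma bin_init_two prev i j A :
  bin_init prev (Bin [i; j] []) A <-> prev i A \/ prev j A.
Proof.
  unfold bin_init; cbn. split.
  - intros [(h & [->|[->|[]]] & H)|(t & [] & _)]; auto.
  - intros [H|H]; left; eauto.
Qed.

Lemma bin_init_one prev i A : bin_init prev (Bin [i] []) A <-> prev i A.
Proof.
  unfold bin_init; cbn. split.
  - intros [(h & [->|[]] & H)|(t & [] & _)]; auto.
  - intros H; left; eauto.
Qed.

Lemma bin_init_add prev i t A :
  bin_init prev (Bin [i] [t]) A <-> prev i A \/ A = single t.
Proof.
  unfold bin_init; cbn. split.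
  - intros [(h & [->|[]] & H)|(u & [->|[]] & H)]; auto.
  - intros [H|H]; [left|right]; eauto.
Qed.

Lemma bin_init_tile prev t A : bin_init prev (Bin [] [t]) A <-> A = single t.
Proof.
  unfold bin_init; cbn. split.
  - intros [(h & [] & H)|(u & [->|[]] & H)]; auto.
  - intros H; right; eauto.
Qed.

Definition bin_ok (prev : nat -> supertile -> Prop) (b : bin) : Prop :=
  exists A, bin_terminal 2 Gl prev b A /\
    forall B, bin_terminal 2 Gl prev b B -> translate_eq A B.

Lemma yields_bin_ok prev b R : yields (bin_terminal 2 Gl prev b) R -> bin_ok prev b.
Proof.
  intros [[A HA] H]. exists A. split; [exact HA|].
  intros B HB. apply (shape_rigid R); auto.
Qed.

Lemma yields_stage prev st j b R :
  nth_error st j = Some b -> yields (bin_terminal 2 Gl prev b) R ->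
  yields (stage_terminal 2 Gl prev st j) R.
Proof.
  intros E [[A HA] H]. split.
  - exists A, b. auto.
  - intros B (b' & E' & HB). apply H. congruence.
Qed.

(** Distinct end labels keep copies of a line from joining each other, so a bin can merely hold a
    line. *)
Lemma yields_line_bin d k f l r prev b :
  wline d k f l r -> l <> r -> yields (bin_init prev b) (line d k f) ->
  yields (bin_terminal 2 Gl prev b) (line d k f).
Proof.
  intros W N H. apply terminal_single; [exact H|].
  intros A B. apply (line_not_combinable d k f l r k f l r); auto.
Qed.

(** * Doubling and incrementing *)

(* [lab] lists the end labels [1, 2, 3] cyclically.  Between stages, bin [idx d i] holds
   a line in direction [d] with start label [lab i] and end label [lab (i + s)], where
   [s] alternates between [1] and [2]. *)
Definition lab (i : nat) : glue := S (i mod 3).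
Definition idx (d : bool) (i : nat) : nat := if d then (3 + i)%nat else i.
Definition ltile (d : bool) (a b : glue) : tile :=
  if d then (Tile b 4 a 0)%nat else (Tile 4 b 0 a)%nat.

Lemma chain_tile d a b : chain d 1 (fun _ => ltile d a b) a b.
Proof. destruct d; repeat constructor; intros; lia. Qed.

Definition six_bins (g : bool -> nat -> bin) : list bin :=
  [g false 0%nat; g false 1%nat; g false 2%nat; g true 0%nat; g true 1%nat; g true 2%nat].

Definition lines_ready (s : nat) (k : Z) (prev : nat -> supertile -> Prop) : Prop :=
  forall d i, (i < 3)%nat -> exists f,
    chain d k f (lab i) (lab (i + s)) /\ yields (prev (idx d i)) (line d k f).

Lemma six_bins_ready s k prev g :
  (forall d i, (i < 3)%nat -> exists f, chain d k f (lab i) (lab (i + s)) /\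
     yields (bin_terminal 2 Gl prev (g d i)) (line d k f)) ->
  lines_ready s k (stage_terminal 2 Gl prev (six_bins g)) /\
  (forall b, In b (six_bins g) -> bin_ok prev b).
Proof.
  intros H. split.
  - intros d i Hi. destruct (H d i Hi) as (f & C & Y). exists f. split; [exact C|].
    apply (yields_stage _ _ _ (g d i)); [|exact Y].
    destruct d, i as [|[|[|i]]]; try lia; reflexivity.
  - intros b Hb. cbn in Hb.
    assert (exists d i, (i < 3)%nat /\ b = g d i) as (d & i & Hi & ->).
    { repeat destruct Hb as [<-|Hb]; [..|contradiction];
        do 2 eexists; (split; [|reflexivity]); lia. }
    destruct (H d i Hi) as (f & _ & Y). eapply yields_bin_ok; eauto.
Qed.

Definition start_stage : list bin :=
  six_bins (fun d i => Bin [] [ltile d (lab i) (lab (i + 1))]).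
(** Bin [i + s] modulo 3 holds the line that starts with the label ending line [i]. The product ends
    in [lab (i + 2 * s)], and [2 * s] is [3 - s] modulo 3, hence the alternation of the step. *)
Definition double_stage (s : nat) : list bin :=
  six_bins (fun d i => Bin [idx d i; idx d ((i + s) mod 3)] []).
(** The added tile leads to the third label, exactly where doubling would end, so both stages change
    the step alike. *)
Definition incr_stage (s : nat) : list bin :=
  six_bins (fun d i => Bin [idx d i] [ltile d (lab (i + s)) (lab (i + (3 - s)))]).

Lemma start_ready prev :
  lines_ready 1 1 (stage_terminal 2 Gl prev start_stage) /\
  (forall b, In b start_stage -> bin_ok prev b).
Proof.
  apply six_bins_ready. intros d i Hi.
  exists (fun _ => ltile d (lab i) (lab (i + 1))).
  split; [apply chain_tile|].
  eapply yields_line_bin; [apply ch_line, chain_tile| |split].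
  - destruct i as [|[|[|i]]]; try lia; discriminate.
  - eexists. apply bin_init_tile. reflexivity.
  - intros A HA. apply bin_init_tile in HA as ->. apply line_single.
Qed.

(** A check of six cases that supplies the distinctness required by [terminal_line_merge]. *)
Lemma lab_facts s i : s = 1%nat \/ s = 2%nat -> (i < 3)%nat ->
  Gl (lab (i + s)) (lab (i + s)) = 2%nat /\ lab i <> lab (i + s) /\
  lab (i + s) <> lab (i + (3 - s)) /\ lab i <> lab (i + (3 - s)) /\
  lab ((i + s) mod 3) = lab (i + s) /\ lab ((i + s) mod 3 + s) = lab (i + (3 - s)).
Proof.
  intros [-> | ->] Hi; destruct i as [|[|[|i]]]; try lia; cbn; repeat split; discriminate.
Qed.

Lemma double_ready s k prev : s = 1%nat \/ s = 2%nat -> lines_ready s k prev ->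
  lines_ready (3 - s) (k + k) (stage_terminal 2 Gl prev (double_stage s)) /\
  (forall b, In b (double_stage s) -> bin_ok prev b).
Proof.
  intros Hs HR. apply six_bins_ready. intros d i Hi.
  destruct (lab_facts s i Hs Hi) as (G2 & lm & mr & lr & E1 & E2).
  destruct (HR d i Hi) as (f & C & Y).
  destruct (HR d ((i + s) mod 3)%nat) as (f' & C' & Y').
  { apply Nat.mod_upper_bound. lia. }
  rewrite E1, E2 in C'.
  exists (fcat k f f'). split; [apply (chain_cat _ _ _ _ _ _ _ _ C C'); lia|].
  eapply terminal_line_merge; [apply C|apply C'| | | | | | | ]; auto.
  - intros A HA. apply bin_init_two in HA. destruct HA; [left; now apply Y|right; now apply Y'].
  - destruct (yields_inv _ _ Y) as (A & ? & ?). exists A. split; [|assumption].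
    apply bin_init_two. auto.
  - destruct (yields_inv _ _ Y') as (A & ? & ?). exists A. split; [|assumption].
    apply bin_init_two. auto.
Qed.

Lemma incr_ready s k prev : s = 1%nat \/ s = 2%nat -> lines_ready s k prev ->
  lines_ready (3 - s) (k + 1) (stage_terminal 2 Gl prev (incr_stage s)) /\
  (forall b, In b (incr_stage s) -> bin_ok prev b).
Proof.
  intros Hs HR. apply six_bins_ready. intros d i Hi.
  destruct (lab_facts s i Hs Hi) as (G2 & lm & mr & lr & _ & _).
  destruct (HR d i Hi) as (f & C & Y).
  pose proof (chain_tile d (lab (i + s)) (lab (i + (3 - s)))) as C'.
  eexists. split; [apply (chain_cat _ _ _ _ _ _ _ _ C C'); lia|].
  eapply terminal_line_merge; [apply C|apply C'| | | | | | | ]; auto.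
  - intros A HA. apply bin_init_add in HA. destruct HA as [HA| ->]; [left; now apply Y|right].
    apply line_single.
  - destruct (yields_inv _ _ Y) as (A & ? & ?). exists A. split; [|assumption].
    apply bin_init_add. auto.
  - eexists. split; [|apply line_single]. apply bin_init_add. auto.
Qed.

(** * The frame and its filling *)

(** Both arms of the frame come from bins with [i = 0] and so start with [lab 0], which is glue 1.
    The null sides seal the corner. *)
Definition corner : tile := (Tile 1 1 0 0)%nat.
Definition filler : tile := (Tile 4 4 4 4)%nat.

Definition square_tile (fH fV : Z -> tile) (x y : Z) : tile :=
  if y =? 0 then fcat 1 (fun _ => corner) fH x
  else if x =? 0 then fV (y - 1) else filler.

(** The side length is [k + 1]: an arm of [k] tiles and the corner. *)
Definition square k fH fV (q : pos) (t : tile) : Prop :=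
  0 <= fst q <= k /\ 0 <= snd q <= k /\ t = square_tile fH fV (fst q) (snd q).

Definition frame k fH fV (q : pos) (t : tile) : Prop :=
  square k fH fV q t /\ (fst q = 0 \/ snd q = 0).

Lemma square_tile_corner fH fV : square_tile fH fV 0 0 = corner.
Proof. reflexivity. Qed.

Lemma square_tile_row fH fV x : 0 < x -> square_tile fH fV x 0 = fH (x - 1).
Proof. intros. unfold square_tile, fcat. cbn. destruct (Z.ltb_spec x 1); [lia|auto]. Qed.

Lemma square_tile_col fH fV y : 0 < y -> square_tile fH fV 0 y = fV (y - 1).
Proof. intros. unfold square_tile. destruct (Z.eqb_spec y 0); [lia|auto]. Qed.

Lemma square_tile_in fH fV x y : 0 < x -> 0 < y -> square_tile fH fV x y = filler.
Proof.
  intros. unfold square_tile.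
  destruct (Z.eqb_spec y 0), (Z.eqb_spec x 0); try lia; auto.
Qed.

(* A frame under filling; the occupied cells form a staircase. *)
Record partial_square k fH fV (a b : Z) (A : supertile) : Prop := {
  ps_nodup : NoDup (dom A);
  ps_cell : forall x y t, In ((x, y), t) A ->
    a <= x <= a + k /\ b <= y <= b + k /\ t = square_tile fH fV (x - a) (y - b);
  ps_left : forall x y, In (x, y) (dom A) -> a < x -> In (x - 1, y) (dom A);
  ps_down : forall x y, In (x, y) (dom A) -> b < y -> In (x, y - 1) (dom A);
  ps_frame : forall x y, a <= x <= a + k -> b <= y <= b + k -> x = a \/ y = b ->
    In (x, y) (dom A) }.

Lemma frame_partial k fH fV a b A :
  shape_at (frame k fH fV) (a, b) A -> partial_square k fH fV a b A.
Proof.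
  intros [N H].
  assert (F : forall x y, a <= x <= a + k -> b <= y <= b + k -> x = a \/ y = b ->
    In (x, y) (dom A)).
  { intros x y Hx Hy Hxy. eapply in_dom. apply H. unfold frame, square. psimp.
    repeat split; lia. }
  constructor; auto.
  - intros x y t I. apply H in I. destruct I as ((?&?&->)&?). psimp. repeat split; lia.
  - intros x y I Hx. apply dom_in in I as [t I]. apply H in I.
    destruct I as ((?&?&->)&?). psimp. apply F; lia.
  - intros x y I Hx. apply dom_in in I as [t I]. apply H in I.
    destruct I as ((?&?&->)&?). psimp. apply F; lia.
Qed.

Lemma combinable_bond A B a b : (forall p, In p (dom A) -> ~ In p (dom B)) ->
  In a A -> In b B -> (2 <= bond Gl a b)%nat -> combinable 2 Gl A B.
Proof.
  intros D Ia Ib H. split; [exact D|]. pose proof (strength_ge A B a b Ia Ib). lia.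
Qed.

(** * From two arms to the frame and the full square *)

Section Filling.
Variables (k : Z) (fH fV : Z -> tile) (r r' : glue).
Hypothesis chH : chain false k fH 1%nat r.
Hypothesis chV : chain true k fV 1%nat r'.

Let kpos : 0 < k := wl_pos _ _ _ _ _ (ch_line _ _ _ _ _ chH).

(** Outer sides of the frame carry null glue, and every other west or south side is covered by the
    staircase property. *)
Lemma partial_sealed a b A : partial_square k fH fV a b A -> sealed A.
Proof.
  intros P x y t I. destruct (ps_cell _ _ _ _ _ _ P _ _ _ I) as (Hx & Hy & ->).
  apply in_dom in I.
  destruct (Z.eq_dec y b) as [->|], (Z.eq_dec x a) as [->|];
    rewrite ?Z.sub_diag, ?square_tile_corner.
  - cbn; auto.
  - rewrite square_tile_row by lia. split.
    + left. apply (wl_back _ _ _ _ _ (ch_line _ _ _ _ _ chH)). lia.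
    + right. apply (ps_left _ _ _ _ _ _ P); auto; lia.
  - rewrite square_tile_col by lia. split.
    + right. apply (ps_down _ _ _ _ _ _ P); auto; lia.
    + left. apply (wl_back _ _ _ _ _ (ch_line _ _ _ _ _ chV)). lia.
  - split; right; [apply (ps_down _ _ _ _ _ _ P)|apply (ps_left _ _ _ _ _ _ P)]; auto; lia.
Qed.

Lemma square_tile_east x y : 0 <= x < k -> 0 < y <= k ->
  gE (square_tile fH fV x y) = 4%nat.
Proof.
  intros. destruct (Z.eq_dec x 0) as [->|].
  - rewrite square_tile_col by lia. apply (ch_front _ _ _ _ _ chV). lia.
  - now rewrite square_tile_in by lia.
Qed.

Lemma square_tile_north x y : 0 < x <= k -> 0 <= y < k ->
  gN (square_tile fH fV x y) = 4%nat.
Proof.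
  intros. destruct (Z.eq_dec y 0) as [->|].
  - rewrite square_tile_row by lia. apply (ch_front _ _ _ _ _ chH). lia.
  - now rewrite square_tile_in by lia.
Qed.

Lemma frame_sealed A : shape (frame k fH fV) A -> sealed A.
Proof. intros [[a b] H]. eapply partial_sealed, frame_partial; eauto. Qed.

Definition base : Z -> tile := fcat 1 (fun _ => corner) fH.

Lemma wline_base : wline false (1 + k) base 0%nat r.
Proof.
  apply (wline_cat false 1 (fun _ => corner) 0%nat 1%nat k fH 1%nat r); [|apply chH].
  constructor; auto; lia.
Qed.

Lemma base_sealed A : shape (line false (1 + k) base) A -> sealed A.
Proof.
  intros [[a b] H] x y t I.
  assert (L := fun p => line_in_dom _ _ _ _ _ p H).
  destruct H as [N H]. apply H in I. destruct I as (I1 & I2 & ->). cbn in I1, I2.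
  split.
  - left. apply (wl_back _ _ _ _ _ wline_base _ I1).
  - destruct (Z.eq_dec x a) as [->|]; [left|right].
    + cbn. now rewrite Z.sub_diag.
    + apply L; cbn; lia.
Qed.

(** The base is row 0 of [square_tile] by conversion. Hence the corner alone offers glue 1 to the
    north. *)
Lemma base_north x : 0 < x <= k -> gN (base x) = 4%nat.
Proof. exact (fun H => square_tile_north x 0 H (conj (Z.le_refl 0) kpos)). Qed.

(** The column, starting with glue 1, can stand only on the corner. On a finished frame the corner
    is covered and the top end shows [r'], different from 1, so no second column attaches. *)
Lemma terminal_frame (init : supertile -> Prop) :
  r <> 0%nat -> r' <> 1%nat ->
  (forall A, init A -> shape (line false (1 + k) base) A \/ shape (line true k fV) A) ->
  (exists A, init A /\ shape (line false (1 + k) base) A) ->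
  (exists B, init B /\ shape (line true k fV) B) ->
  yields (terminal 2 Gl init) (frame k fH fV).
Proof.
  intros r0 r1' Hi HA HB.
  pose proof (ch_line _ _ _ _ _ chV) as WV.
  apply (terminal_merge (line false (1 + k) base) (line true k fV) _ (0, 1)); auto.
  - intros [x y] t. unfold frame, square, line, square_tile. psimp; cbn [along across fst snd].
    fold base. destruct (Z.eqb_spec y 0), (Z.eqb_spec x 0); intuition lia.
  - intros [vx vy] A B [_ sA] [_ sB].
    apply (combinable_bond A B ((vx, vy), corner) ((vx, vy + 1), fV 0)).
    + intros [x y] pA pB. apply dom_in in pA as [t pA]. apply dom_in in pB as [u pB].
      apply sA in pA. apply sB in pB. destruct pA as (a1&a2&_), pB as (b1&b2&_).
      cbn in *. lia.
    + apply sA. unfold line. psimp. cbn [along across fst snd].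
      rewrite !Z.sub_diag. split; [lia|auto].
    + apply sB. unfold line. psimp. cbn [along across fst snd].
      rewrite Z.add_0_r, !Z.sub_diag. split; [lia|auto].
    + rewrite bond_north. cbn [gN corner].
      pose proof (wl_start _ _ _ _ _ WV) as E. cbn in E. now rewrite E.
  - intros [vx vy] u A B sA sB C.
    destruct (column_on_sealed _ _ _ _ _ A _ WV sB) as (x & y & t & I & -> & E);
      auto.
    { apply base_sealed. eexists; eauto. }
    apply sA in I. destruct I as (I1 & I2 & ->). psimp. cbn [along across fst snd] in I1, I2, E.
    destruct (Z.eq_dec x vx) as [->|].
    + unfold padd; cbn. f_equal; lia.
    + rewrite base_north in E by lia. discriminate.
  - intros A B. apply (line_not_combinable _ _ _ _ _ _ _ _ _ _ _ wline_base wline_base); auto.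
  - intros A B. apply (line_not_combinable _ _ _ _ _ _ _ _ _ _ _ WV WV); auto.
  - intros A B SA SB. apply sealed_not_combinable; [now apply frame_sealed|now apply base_sealed].
  - intros A B SA [v sB] C.
    destruct (column_on_sealed _ _ _ _ _ A _ WV sB) as (x & y & t & I & -> & E);
      auto using frame_sealed.
    destruct SA as [[a b] SA]. pose proof (frame_partial _ _ _ _ _ _ SA) as P.
    destruct (proj2 SA (x, y) t) as [F _]. specialize (F I).
    destruct F as ((F1 & F2 & F3) & F4). psimp.
    (* The column occupies the cell above its support, which leaves the top of the left arm, with
       glue [r'], and the bottom row off the corner, with glue 4. *)
    assert (top : ~ In (x, y + 1) (dom A)).
    { intros J. apply (proj1 C _ J). eapply line_in_dom; [exact sB|..]; cbn; lia. }
    destruct (Z.eq_dec y (b + k)) as [->|].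
    + destruct F4; [|lia]. replace x with a in * by lia.
      rewrite Z.sub_diag, square_tile_col in F3 by lia. subst t.
      replace (b + k - b - 1) with (k - 1) in E by lia.
      pose proof (wl_end _ _ _ _ _ WV) as E'. cbn in E'. congruence.
    + destruct (Z.eq_dec x a) as [->|].
      * apply top. apply (ps_frame _ _ _ _ _ _ P); lia.
      * subst t. rewrite square_tile_north in E by lia. discriminate.
  - intros A B SA SB. apply sealed_not_combinable; now apply frame_sealed.
Qed.

(** * Attaching single filler tiles *)

Definition dot (x y : Z) : supertile := [((x, y), filler)].

Lemma strength_dot A x y :
  strength Gl A (dot x y) = list_sum (map (fun a => bond Gl a ((x, y), filler)) A).
Proof.
  unfold strength, dot. f_equal. apply map_ext. intros a. cbn. lia.
Qed.

Lemma bond_filler_le a x y : (bond Gl a ((x, y), filler) <= 1)%nat.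
Proof.
  destruct a as [[px py] t]. unfold bond. cbn [filler gN gE gS gW].
  repeat match goal with |- context [if ?c then _ else _] => destruct c end;
    auto using Gl_4_le.
Qed.

Lemma dot_dot x y x' y' : ~ combinable 2 Gl (dot x y) (dot x' y').
Proof.
  intros [_ H]. rewrite strength_dot in H. cbn [dot map list_sum fold_right] in H.
  pose proof (bond_filler_le ((x, y), filler) x' y'). cbn - [bond] in H. lia.
Qed.

Lemma touch_filler a b A x y c :
  partial_square k fH fV a b A -> ~ In (x, y) (dom A) ->
  In c A -> (0 < bond Gl c ((x, y), filler))%nat ->
  fst c = (x - 1, y) \/ fst c = (x, y - 1).
Proof.
  intros P N Ic Hb. apply bond_pos in Hb. destruct Hb as [T|T].
  - inversion T; subst; cbn [fst]; [left|right]; f_equal; lia.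
  - destruct N. exact (sealed_touch _ _ _ (partial_sealed _ _ _ P) Ic T).
Qed.

(** Each bond of a filler is worth at most 1, and a sealed supertile bonds it only from the west and
    the south, so both neighbours are present. The southern one bounds [x] by [a + k] and the
    western one bounds [y] by [b + k], which keeps growth inside the square. *)
Lemma dot_position a b A x y :
  partial_square k fH fV a b A -> combinable 2 Gl A (dot x y) ->
  ~ In (x, y) (dom A) /\ In (x - 1, y) (dom A) /\ In (x, y - 1) (dom A) /\
  a < x <= a + k /\ b < y <= b + k.
Proof.
  intros P [D H]. rewrite strength_dot in H.
  assert (N : ~ In (x, y) (dom A)) by (intros I; apply (D _ I); now left).
  assert (In (x - 1, y) (dom A) /\ In (x, y - 1) (dom A)) as [I1 I2].
  { destruct (list_sum_two _ A (ps_nodup _ _ _ _ _ _ P)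
      (fun c _ => bond_filler_le c x y) H) as (c & d & Ic & Id & ne & Hc & Hd).
    apply in_map with (f := fst) in Ic as Ic', Id as Id'.
    destruct (touch_filler _ _ _ _ _ _ P N Ic Hc) as [Ec|Ec],
      (touch_filler _ _ _ _ _ _ P N Id Hd) as [Ed|Ed]; rewrite Ec in *; rewrite Ed in *;
      try congruence; auto. }
  destruct (dom_in _ _ I1) as [t J1], (dom_in _ _ I2) as [u J2].
  apply (ps_cell _ _ _ _ _ _ P) in J1, J2. repeat split; auto; lia.
Qed.

Lemma dot_combinable a b A x y :
  partial_square k fH fV a b A ->
  ~ In (x, y) (dom A) -> In (x - 1, y) (dom A) -> In (x, y - 1) (dom A) ->
  a < x <= a + k -> b < y <= b + k -> combinable 2 Gl A (dot x y).
Proof.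
  intros P N I1 I2 Hx Hy. split.
  - intros p Ip [<-|[]]. auto.
  - rewrite strength_dot.
    destruct (dom_in _ _ I1) as [t J1], (dom_in _ _ I2) as [u J2].
    destruct (ps_cell _ _ _ _ _ _ P _ _ _ J1) as (_ & _ & Et).
    destruct (ps_cell _ _ _ _ _ _ P _ _ _ J2) as (_ & _ & Eu).
    (* The western and the southern neighbour each show glue 4 to the new cell, giving 1 + 1. *)
    eapply Nat.le_trans; [|apply (list_sum_ge2 _ _ _ _ J1 J2)].
    + pose proof (bond_east (x - 1) y t filler) as E.
      pose proof (bond_north x (y - 1) u filler) as F.
      rewrite Z.sub_add in E, F. cbn beta. unfold pos. rewrite E, F.
      rewrite Et, square_tile_east by lia. rewrite Eu, square_tile_north by lia. cbn. lia.
    + intros E. inversion E. lia.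
Qed.

(** The staircase property survives because the new cell has its left and lower neighbours. [B] is
    given by its elements to allow both orders of appending. *)
Lemma partial_add a b A B x y :
  partial_square k fH fV a b A -> combinable 2 Gl A (dot x y) ->
  NoDup (dom B) -> (forall c, In c B <-> In c A \/ In c (dot x y)) ->
  partial_square k fH fV a b B.
Proof.
  intros P C N H.
  destruct (dot_position _ _ _ _ _ P C) as (_ & I1 & I2 & Hx & Hy).
  assert (HD : forall p, In p (dom B) <-> In p (dom A) \/ p = (x, y)).
  { intros p. unfold dom at 1 2. rewrite !in_map_iff. split.
    - intros (c & <- & I). apply H in I. destruct I as [I|[<-|[]]]; eauto.
    - intros [(c & <- & I)| ->]; [exists c|exists ((x, y), filler)];
        (split; [reflexivity|]); apply H; [auto|right; now left]. }
  destruct P as [PN Pc Pl Pd Pf]. constructor; auto.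
  - intros p q t I. apply H in I. destruct I as [I|[E|[]]]; [auto|].
    inversion E; subst. rewrite square_tile_in by lia. repeat split; lia.
  - intros p q I Hp. apply HD. apply HD in I. destruct I as [I|E]; [auto|].
    inversion E; subst; auto.
  - intros p q I Hp. apply HD. apply HD in I. destruct I as [I|E]; [auto|].
    inversion E; subst; auto.
  - intros p q ? ? ?. apply HD. left. auto.
Qed.

Lemma partial_app_dot a b A x y :
  partial_square k fH fV a b A -> combinable 2 Gl A (dot x y) ->
  partial_square k fH fV a b (A ++ dot x y) /\ partial_square k fH fV a b (dot x y ++ A).
Proof.
  intros P C. pose proof (ps_nodup _ _ _ _ _ _ P) as N.
  assert (ND : NoDup (dom (dot x y))) by (repeat constructor; auto).
  destruct C as [D S].
  split; (eapply partial_add; [exact P|split; [exact D|exact S]|..]).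
  - now apply NoDup_dom_app.
  - intros c. apply in_app_iff.
  - apply NoDup_dom_app; firstorder.
  - intros c. rewrite in_app_iff. tauto.
Qed.

(** * The bin that fills the frame *)

Section FillBin.
Variable init : supertile -> Prop.
Hypothesis init_cases : forall A, init A -> shape (frame k fH fV) A \/ A = single filler.
Hypothesis init_frame : exists A, init A /\ shape (frame k fH fV) A.
Hypothesis init_filler : init (single filler).

Lemma produced_dot x y : produced 2 Gl init (dot x y).
Proof. exact (prod_init 2 Gl init (single filler) (x, y) init_filler). Qed.

(** The invariant of the bin: two partial squares are sealed and do not combine, two fillers share a
    bond of at most 1, and a filler on a partial square gives a partial square. *)
Lemma produced_fill A : produced 2 Gl init A ->
  (exists a b, partial_square k fH fV a b A) \/ exists x y, A = dot x y.
Proof.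
  induction 1 as [A [v w] H|A B _ IA _ IB C].
  - destruct (init_cases A H) as [S| ->].
    + left. apply (shape_shift _ (v, w)) in S. destruct S as [[a b] S].
      exists a, b. now apply frame_partial.
    + right. exists v, w. reflexivity.
  - destruct IA as [(a & b & PA)|(x & y & ->)], IB as [(a' & b' & PB)|(x' & y' & ->)].
    + destruct (sealed_not_combinable A B); eauto using partial_sealed.
    + left. exists a, b. now apply partial_app_dot.
    + left. exists a', b'. apply combinable_sym in C. now apply partial_app_dot.
    + destruct (dot_dot _ _ _ _ C).
Qed.

Definition full (a b : Z) (A : supertile) : Prop :=
  forall x y, a <= x <= a + k -> b <= y <= b + k -> In (x, y) (dom A).

Lemma full_square a b A : partial_square k fH fV a b A -> full a b A ->
  shape_at (square k fH fV) (a, b) A.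
Proof.
  intros P F. split; [apply (ps_nodup _ _ _ _ _ _ P)|].
  intros [x y] t. unfold square. psimp. split.
  - intros I. apply (ps_cell _ _ _ _ _ _ P) in I. intuition lia.
  - intros (Hx & Hy & ->). destruct (dom_in (x, y) A) as [t I]; [apply F; lia|].
    destruct (ps_cell _ _ _ _ _ _ P _ _ _ I) as (_ & _ & <-). exact I.
Qed.

Lemma full_terminal a b A : partial_square k fH fV a b A -> full a b A ->
  produced 2 Gl init A -> terminal 2 Gl init A.
Proof.
  intros P F HA. split; [exact HA|]. intros B HB C.
  destruct (produced_fill B HB) as [(a' & b' & PB)|(x & y & ->)].
  - revert C. apply sealed_not_combinable; eauto using partial_sealed.
  - apply (dot_position _ _ _ _ _ P) in C. destruct C as (N & _ & _ & Hx & Hy).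
    apply N, F; lia.
Qed.

(** Going row by row from the west, the first free cell would have both its left and lower
    neighbours and could take a filler. *)
Lemma terminal_full a b A : partial_square k fH fV a b A -> terminal 2 Gl init A ->
  full a b A.
Proof.
  intros P [_ HT].
  assert (H : forall j i : nat, Z.of_nat i <= k -> Z.of_nat j <= k ->
    In (a + Z.of_nat i, b + Z.of_nat j) (dom A)).
  { induction j as [|j IHj]; [intros; apply (ps_frame _ _ _ _ _ _ P); lia|].
    induction i as [|i IHi]; intros Hi Hj; [apply (ps_frame _ _ _ _ _ _ P); lia|].
    destruct (In_dec (fun p q : pos => ltac:(decide equality; apply Z.eq_dec))
      (a + Z.of_nat (S i), b + Z.of_nat (S j)) (dom A)) as [I|I]; [exact I|].
    destruct (HT _ (produced_dot (a + Z.of_nat (S i)) (b + Z.of_nat (S j)))).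
    apply (dot_combinable a b); auto; try lia.
    - replace (a + Z.of_nat (S i) - 1) with (a + Z.of_nat i) by lia. apply IHi; lia.
    - replace (b + Z.of_nat (S j) - 1) with (b + Z.of_nat j) by lia. apply IHj; lia. }
  intros x y Hx Hy. specialize (H (Z.to_nat (y - b)) (Z.to_nat (x - a))).
  rewrite !Z2Nat.id in H by lia.
  replace (a + (x - a)) with x in H by lia. replace (b + (y - b)) with y in H by lia.
  apply H; lia.
Qed.

(** Reachability of the full square: cells are filled row by row from the west, up to column [i] of
    row [j]. *)
Lemma fill_rows a b A (j i : nat) :
  Z.of_nat i <= k -> Z.of_nat j <= k ->
  produced 2 Gl init A -> partial_square k fH fV a b A ->
  exists B, produced 2 Gl init B /\ partial_square k fH fV a b B /\
    forall x y, a <= x <= a + k -> b <= y ->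
      y < b + Z.of_nat j \/ y = b + Z.of_nat j /\ x <= a + Z.of_nat i -> In (x, y) (dom B).
Proof.
  intros Hi Hj HA PA. revert i Hi. induction j as [|j IHj].
  - intros i Hi. exists A. split; [|split]; auto. intros. apply (ps_frame _ _ _ _ _ _ PA); lia.
  - induction i as [|i IHi]; intros Hi.
    (* A new row starts once the row below is complete; its cell in column 0 belongs to the
       frame. *)
    + destruct (IHj ltac:(lia) (Z.to_nat k)) as (B & HB & PB & H); [lia|].
      exists B. split; [|split]; auto. intros x y Hx Hy Hxy.
      destruct (Z.eq_dec y (b + Z.of_nat (S j))); [apply (ps_frame _ _ _ _ _ _ PB); lia|].
      apply H; lia.
    + destruct IHi as (B & HB & PB & H); [lia|].
      set (x0 := a + Z.of_nat (S i)). set (y0 := b + Z.of_nat (S j)).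
      destruct (In_dec (fun p q : pos => ltac:(decide equality; apply Z.eq_dec))
        (x0, y0) (dom B)) as [I|I].
      * exists B. split; [|split]; auto. intros x y Hx Hy Hxy.
        destruct (Z.eq_dec x x0), (Z.eq_dec y y0); subst; auto; apply H; lia.
      * assert (C : combinable 2 Gl B (dot x0 y0)).
        { apply (dot_combinable a b); auto; try lia; apply H; lia. }
        exists (B ++ dot x0 y0). split; [|split].
        -- apply prod_comb; auto using produced_dot.
        -- now apply partial_app_dot.
        -- intros x y Hx Hy Hxy. rewrite dom_app. apply in_app_iff.
           destruct (Z.eq_dec x x0), (Z.eq_dec y y0); subst;
             [right; now left|left; apply H; lia..].
Qed.

Lemma terminal_fill : yields (terminal 2 Gl init) (square k fH fV).
Proof.
  assert (F : exists A0 a0 b0, produced 2 Gl init A0 /\ partial_square k fH fV a0 b0 A0).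
  { destruct init_frame as (A & iA & [[a b] S]).
    exists (shift (0, 0) A), (a + 0), (b + 0). split; [now constructor|].
    apply frame_partial. exact (shape_at_shift _ _ (0, 0) _ S). }
  destruct F as (A0 & a0 & b0 & H0 & P0). split.
  - destruct (fill_rows a0 b0 A0 (Z.to_nat k) (Z.to_nat k)) as (B & HB & PB & H); auto; try lia.
    exists B. apply (full_terminal a0 b0); auto. intros x y Hx Hy. apply H; lia.
  - intros A HA. destruct (produced_fill A (proj1 HA)) as [(a & b & P)|(x & y & ->)].
    + exists (a, b). apply full_square; auto. now apply terminal_full.
    + exfalso.
      destruct HA as [_ HT].
      destruct init_frame as (A & iA & [v S]).
      (* A lone filler is not terminal: it fits the inner angle of a frame whose corner lies
         diagonally below it to the west. *)
      apply (shape_at_move _ _ (x - 1, y - 1)) in S.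
      apply (HT (shift (psub (x - 1, y - 1) v) A)); [now constructor|].
      assert (N : ~ In (x, y) (dom (shift (psub (x - 1, y - 1) v) A))).
      { intros I. apply dom_in in I as [t I]. apply S in I. destruct I as [_ I].
        psimp. lia. }
      apply frame_partial in S. apply combinable_sym.
      apply (dot_combinable (x - 1) (y - 1)); auto; try lia.
      all: apply (ps_frame _ _ _ _ _ _ S); lia.
Qed.
End FillBin.

(** * Bonds inside the square and its shape *)

(** Only the bottom row relies on the links of the chain; above it the eastern tile is a filler and
    both facing glues are 4. *)
Lemma square_tile_link_east x y : 0 <= x < k -> 0 <= y <= k ->
  (0 < Gl (gE (square_tile fH fV x y)) (gW (square_tile fH fV (x + 1) y)))%nat.
Proof.
  intros Hx Hy. destruct (Z.eq_dec y 0) as [->|].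
  - rewrite (square_tile_row _ _ (x + 1)) by lia. rewrite Z.add_simpl_r.
    destruct (Z.eq_dec x 0) as [->|].
    + pose proof (wl_start _ _ _ _ _ (ch_line _ _ _ _ _ chH)) as E. cbn in E.
      rewrite E. cbn. lia.
    + rewrite square_tile_row by lia.
      pose proof (ch_link _ _ _ _ _ chH (x - 1)) as L. rewrite Z.sub_add in L. apply L. lia.
  - rewrite square_tile_east, square_tile_in by lia. cbn. lia.
Qed.

Lemma square_tile_link_north x y : 0 <= x <= k -> 0 <= y < k ->
  (0 < Gl (gN (square_tile fH fV x y)) (gS (square_tile fH fV x (y + 1))))%nat.
Proof.
  intros Hx Hy. destruct (Z.eq_dec x 0) as [->|].
  - rewrite (square_tile_col _ _ (y + 1)) by lia. rewrite Z.add_simpl_r.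
    destruct (Z.eq_dec y 0) as [->|].
    + pose proof (wl_start _ _ _ _ _ (ch_line _ _ _ _ _ chV)) as E. cbn in E.
      rewrite E. cbn. lia.
    + rewrite square_tile_col by lia.
      pose proof (ch_link _ _ _ _ _ chV (y - 1)) as L. rewrite Z.sub_add in L. apply L. lia.
  - rewrite square_tile_north, square_tile_in by lia. cbn. lia.
Qed.

Lemma square_fully_connected A : shape (square k fH fV) A -> fully_connected Gl A.
Proof.
  intros [[a b] [_ H]].
  assert (HE : forall x y t u, In ((x, y), t) A -> In ((x + 1, y), u) A ->
    (0 < bond Gl ((x, y), t) ((x + 1, y)%Z, u))%nat).
  { intros x y t u It Iu. apply H in It, Iu.
    destruct It as (Tx & Ty & ->), Iu as (Ux & Uy & ->). psimp. rewrite bond_east.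
    replace (x + 1 - a) with (x - a + 1) by lia. apply square_tile_link_east; lia. }
  assert (HN : forall x y t u, In ((x, y), t) A -> In ((x, y + 1), u) A ->
    (0 < bond Gl ((x, y), t) ((x, y + 1)%Z, u))%nat).
  { intros x y t u It Iu. apply H in It, Iu.
    destruct It as (Tx & Ty & ->), Iu as (Ux & Uy & ->). psimp. rewrite bond_north.
    replace (y + 1 - b) with (y - b + 1) by lia. apply square_tile_link_north; lia. }
  intros [[x y] t] [[x' y'] u] It Iu Hadj. unfold adjacent in Hadj. cbn [fst snd] in Hadj.
  assert ((x' = x + 1 /\ y' = y) \/ (x' = x /\ y' = y + 1) \/
          (x = x' + 1 /\ y = y') \/ (x = x' /\ y = y' + 1)) as D by lia.
  destruct D as [[-> ->]|[[-> ->]|[[-> ->]|[-> ->]]]]; auto;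
    rewrite bond_sym; auto.
Qed.

Lemma square_has_square_shape A : shape (square k fH fV) A ->
  has_square_shape (Z.to_nat (k + 1)) A.
Proof.
  intros [[a b] [_ H]]. exists (a, b). intros [x y]. psimp.
  rewrite Z2Nat.id by lia. split.
  - intros I. apply dom_in in I as [t I]. apply H in I.
    destruct I as (I1 & I2 & _). psimp. lia.
  - intros I. eapply in_dom. apply H. unfold square. psimp. repeat split; lia.
Qed.

End Filling.

(** * The staged system *)

(** Bins 0 and 3 are [idx false 0] and [idx true 0]. The corner joins the row while the column waits
    in its own bin, then the column is added, then the fillers. *)
Definition final_stages : list (list bin) :=
  [ [Bin [0%nat] [corner]; Bin [3%nat] []];
    [Bin [0%nat; 1%nat] []];
    [Bin [0%nat] [filler]] ].

Lemma lab_end s : s = 1%nat \/ s = 2%nat -> lab s <> 0%nat /\ lab s <> 1%nat.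
Proof. intros [-> | ->]; split; discriminate. Qed.

Lemma final_stages_correct s k prev : s = 1%nat \/ s = 2%nat -> lines_ready s k prev ->
  bins_unique 2 Gl prev final_stages /\
  exists fH fV r r', chain false k fH 1%nat r /\ chain true k fV 1%nat r' /\
    yields (final_terminal 2 Gl prev final_stages 0%nat) (square k fH fV).
Proof.
  intros Hs HR.
  destruct (HR false 0%nat ltac:(lia)) as (fH & CH & YH).
  destruct (HR true 0%nat ltac:(lia)) as (fV & CV & YV).
  destruct (lab_end s Hs) as [N0 N1].
  change (lab 0) with 1%nat in CH, CV. rewrite Nat.add_0_l in CH, CV. cbn [idx] in YH, YV.
  set (st1 := [Bin [0%nat] [corner]; Bin [3%nat] []]).
  (* The corner is treated as a row of length 1 with ends 0 and 1, so adding it is another merge of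
     lines. *)
  assert (Y1 : yields (bin_terminal 2 Gl prev (Bin [0%nat] [corner]))
    (line false (1 + k) (base fH))).
  { apply (terminal_line_merge false 1 (fun _ => corner) 0%nat 1%nat k fH (lab s)); auto.
    - constructor; auto; lia.
    - apply CH.
    - intros A HA. apply bin_init_add in HA. destruct HA as [HA| ->];
        [right; now apply YH|left; apply line_single].
    - eexists. split; [|apply line_single]. apply bin_init_add. auto.
    - destruct (yields_inv _ _ YH) as (A & ? & ?). exists A. split; [|assumption].
      apply bin_init_add. auto. }
  assert (Y2 : yields (bin_terminal 2 Gl prev (Bin [3%nat] [])) (line true k fV)).
  { eapply yields_line_bin; [apply CV|congruence|split].
    - destruct YV as [[A HA] _]. exists A. now apply bin_init_one.
    - intros A HA. apply bin_init_one in HA. now apply YV. }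
  pose proof (yields_stage prev st1 0 _ _ eq_refl Y1) as Z1.
  pose proof (yields_stage prev st1 1 _ _ eq_refl Y2) as Z2.
  set (prev1 := stage_terminal 2 Gl prev st1) in *.
  assert (Y3 : yields (bin_terminal 2 Gl prev1 (Bin [0%nat; 1%nat] [])) (frame k fH fV)).
  { apply (terminal_frame k fH fV (lab s) (lab s)); auto.
    - intros A HA. apply bin_init_two in HA.
      destruct HA; [left; now apply Z1|right; now apply Z2].
    - destruct (yields_inv _ _ Z1) as (A & ? & ?). exists A. split; [|assumption].
      apply bin_init_two. auto.
    - destruct (yields_inv _ _ Z2) as (A & ? & ?). exists A. split; [|assumption].
      apply bin_init_two. auto. }
  pose proof (yields_stage prev1 [Bin [0%nat; 1%nat] []] 0 _ _ eq_refl Y3) as Z3.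
  set (prev2 := stage_terminal 2 Gl prev1 [Bin [0%nat; 1%nat] []]) in *.
  assert (Y4 : yields (bin_terminal 2 Gl prev2 (Bin [0%nat] [filler])) (square k fH fV)).
  { apply (terminal_fill k fH fV (lab s) (lab s)); auto.
    - intros A HA. apply bin_init_add in HA.
      destruct HA as [HA| ->]; [left; now apply Z3|now right].
    - destruct (yields_inv _ _ Z3) as (A & ? & ?). exists A. split; [|assumption].
      apply bin_init_add. auto.
    - apply bin_init_add. auto. }
  split.
  - cbn [bins_unique final_stages]. fold st1. fold prev1. fold prev2.
    repeat split; intros b Hb; cbn in Hb.
    + destruct Hb as [<-|[<-|[]]]; eapply yields_bin_ok; eauto.
    + destruct Hb as [<-|[]]; eapply yields_bin_ok; eauto.
    + destruct Hb as [<-|[]]; eapply yields_bin_ok; eauto.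
  - exists fH, fV, (lab s), (lab s). repeat split; try apply CH; try apply CV;
      cbn [final_terminal final_stages]; fold st1 prev1 prev2;
      apply (yields_stage prev2 [Bin [0%nat] [filler]] 0 _ _ eq_refl Y4).
Qed.

(* Binary recipe for the side length: [false] doubles it, [true] increments it. *)
Definition op_stage (o : bool) (s : nat) : list bin :=
  if o then incr_stage s else double_stage s.
Definition op_length (k : Z) (o : bool) : Z := if o then k + 1 else k + k.

Fixpoint run (s : nat) (ops : list bool) : list (list bin) :=
  match ops with
  | [] => final_stages
  | o :: ops => op_stage o s :: run (3 - s) ops
  end.

Lemma op_ready o s k prev : s = 1%nat \/ s = 2%nat -> lines_ready s k prev ->
  lines_ready (3 - s) (op_length k o) (stage_terminal 2 Gl prev (op_stage o s)) /\
  (forall b, In b (op_stage o s) -> bin_ok prev b).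
Proof. destruct o; [apply incr_ready|apply double_ready]. Qed.

Lemma run_correct ops s k prev : s = 1%nat \/ s = 2%nat -> lines_ready s k prev ->
  bins_unique 2 Gl prev (run s ops) /\
  exists fH fV r r', chain false (fold_left op_length ops k) fH 1%nat r /\
    chain true (fold_left op_length ops k) fV 1%nat r' /\
    yields (final_terminal 2 Gl prev (run s ops) 0%nat)
      (square (fold_left op_length ops k) fH fV).
Proof.
  revert s k prev. induction ops as [|o ops IH]; intros s k prev Hs HR.
  - now apply final_stages_correct with s.
  - destruct (op_ready o s k prev Hs HR) as [HR' HB].
    destruct (IH (3 - s)%nat _ _ ltac:(lia) HR') as [U Y].
    split; [split; [exact HB|exact U]|exact Y].
Qed.

(** Binary digits are read from the leading one: each further digit costs a doubling, and a digit 1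
    also an increment. *)
Lemma binary_ops (p : positive) : exists ops,
  fold_left op_length ops 1 = Z.pos p /\
  (length ops <= 2 * Nat.log2 (Pos.to_nat p))%nat.
Proof.
  induction p as [p (ops & E & L)|p (ops & E & L)|].
  - exists (ops ++ [false; true]). rewrite fold_left_app, E, length_app.
    cbn [fold_left op_length length].
    split; [lia|]. replace (Pos.to_nat p~1) with (2 * Pos.to_nat p + 1)%nat by lia.
    rewrite Nat.log2_succ_double by lia. lia.
  - exists (ops ++ [false]). rewrite fold_left_app, E, length_app.
    cbn [fold_left op_length length].
    split; [lia|]. rewrite Pos2Nat.inj_xO, Nat.log2_double by lia. lia.
  - exists []. cbn. split; [reflexivity|lia].
Qed.

(** * Well-formedness and complexity counts *)

Lemma length_run s ops : length (run s ops) = (length ops + 3)%nat.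
Proof. revert s; induction ops; intros s; cbn; auto. Qed.

Lemma last_run s ops l : last (l :: run s ops) [] = [Bin [0%nat] [filler]].
Proof. revert s l; induction ops as [|o ops IH]; intros s l; [reflexivity|apply IH]. Qed.

Lemma run_wf s ops : stages_wf (Some 6%nat) (run s ops).
Proof.
  assert (M : forall i, (i mod 3 < 3)%nat) by (intros; apply Nat.mod_upper_bound; lia).
  revert s. induction ops as [|o ops IH]; intros s.
  - cbn. repeat split; intros b Hb;
      repeat (destruct Hb as [<-|Hb]; [cbn; intros j Hj; intuition lia|]); destruct Hb.
  - split; [|destruct o; apply IH].
    destruct o; intros b Hb; cbn [op_stage incr_stage double_stage six_bins] in Hb;
      repeat (destruct Hb as [<-|Hb];
        [cbn [bin_from idx]; intros j Hj;
         repeat (destruct Hj as [<-|Hj]; [first [lia | match goal with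
           |- context [(?i mod 3)%nat] => specialize (M i); lia end]|]); destruct Hj|]);
      destruct Hb.
Qed.

Lemma run_bins s ops : list_max (map (@length bin) (run s ops)) =
  match ops with [] => 2%nat | _ => 6%nat end.
Proof.
  revert s. induction ops as [|o ops IH]; intros s; [reflexivity|].
  cbn [run map].
  change (Nat.max (length (op_stage o s))
    (list_max (map (@length bin) (run (3 - s) ops))) = 6%nat).
  rewrite IH. destruct o, ops; reflexivity.
Qed.

(** Corner, filler, and for each direction one tile per ordered pair of distinct labels: 2 + 2 * 6 =
    14. *)
Definition all_tiles : list tile :=
  [corner; filler] ++
  flat_map (fun d => [ltile d 1 2; ltile d 1 3; ltile d 2 1; ltile d 2 3;
    ltile d 3 1; ltile d 3 2]%nat)
    [false; true].

Lemma run_tiles s ops : s = 1%nat \/ s = 2%nat ->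
  incl (flat_map (flat_map bin_tiles) (run s ops)) all_tiles.
Proof.
  revert s. induction ops as [|o ops IH]; intros s Hs.
  - intros t Ht. cbn in Ht. destruct Ht as [<-|[<-|[]]]; cbn; auto.
  - cbn [run flat_map]. apply incl_app; [|apply IH; lia].
    destruct o; [|intros t []].
    destruct Hs as [-> | ->]; intros t Ht; cbn in Ht |- *; tauto.
Qed.

Definition square_system (ops : list bool) : system :=
  System 2 Gl (start_stage :: run 1 ops) [0%nat].

Lemma uniquely_assembles_yields st stages R P :
  bins_unique 2 Gl no_bins (st :: stages) ->
  yields (final_terminal 2 Gl no_bins (st :: stages) 0%nat) R ->
  final_terminal 2 Gl no_bins (st :: stages) 0%nat P ->
  uniquely_assembles (System 2 Gl (st :: stages) [0%nat]) P.
Proof.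
  intros U [_ Y] HP. split; [exact U|split].
  - exists 0%nat. split; [now left|exact HP].
  - intros j A [<-|[]] HA. apply (shape_rigid R); apply Y; assumption.
Qed.

Lemma nodup_length_incl {T} (dec : forall x y : T, {x = y} + {x <> y}) l l' :
  incl l l' -> (length (nodup dec l) <= length l')%nat.
Proof.
  intros H. apply NoDup_incl_length; [apply NoDup_nodup|].
  intros x Hx. apply nodup_In in Hx. auto.
Qed.

Lemma complexity_bounds S : incl (tiles_used S) all_tiles ->
  (glue_complexity S <= 4)%nat /\ (tile_complexity S <= 14)%nat.
Proof.
  intros H. split.
  - apply (nodup_length_incl _ _ [1; 2; 3; 4]%nat).
    intros g Hg. apply filter_In in Hg. destruct Hg as [Hg Hn].
    apply in_flat_map in Hg. destruct Hg as (t & Ht & Hg). apply H in Ht.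
    cbn in Ht. repeat (destruct Ht as [<-|Ht]; [cbn in Hg;
      repeat (destruct Hg as [<-|Hg]; [cbn in Hn |- *; first [discriminate|tauto]|]);
      destruct Hg|]).
    destruct Ht.
  - exact (nodup_length_incl tile_eq_dec _ all_tiles H).
Qed.

Lemma tiles_used_square_system ops : incl (tiles_used (square_system ops)) all_tiles.
Proof.
  unfold tiles_used, square_system. cbn [sys_stages flat_map]. apply incl_app.
  - intros t Ht; cbn in Ht |- *; tauto.
  - apply run_tiles. auto.
Qed.

(** * Side length 1 and the general case *)

(** The frame needs arms of at least one tile, so side length 1 gets a system of its own, with a
    single bin holding the corner. *)
Lemma unit_square : exists (S : system) (P : supertile),
  system_wf S /\ sys_temp S = 2%nat /\ uniquely_assembles S P /\
  has_square_shape 1 P /\ fully_connected (sys_glue S) P /\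
  stage_complexity S = 1%nat /\ (glue_complexity S <= 4)%nat /\
  (tile_complexity S <= 14)%nat /\ (bin_complexity S <= 7)%nat.
Proof.
  set (b := Bin [] [corner]).
  assert (Y : yields (bin_terminal 2 Gl no_bins b) (line false 1 (fun _ => corner))).
  { apply (yields_line_bin _ _ _ 0%nat 1%nat); [constructor; auto; lia|lia|split].
    - exists (single corner). now apply bin_init_tile.
    - intros A HA. apply bin_init_tile in HA as ->. apply line_single. }
  pose proof (yields_stage no_bins [b] 0 b _ eq_refl Y) as Y'.
  destruct (yields_inv _ _ Y') as (P & HP & [[vx vy] [_ S]]).
  exists (System 2 Gl [[b]] [0%nat]), P.
  assert (B := complexity_bounds (System 2 Gl [[b]] [0%nat])).
  destruct B as [B1 B2]; [intros t Ht; cbn in Ht |- *; tauto|].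
  split; [|split; [reflexivity|split; [|split; [|split; [|split; [reflexivity|
    split; [exact B1|split; [exact B2|cbn; lia]]]]]]]].
  - split; [cbn; lia|split; [apply Gl_valid|split; [discriminate|split]]].
    + cbn. split; [|exact I]. intros c [<-|[]] j [].
    + intros j [<-|[]]. cbn. lia.
  - apply (uniquely_assembles_yields _ _ (line false 1 (fun _ => corner))); auto.
    split; [|exact I]. intros c [<-|[]]. eapply yields_bin_ok; eauto.
  - exists (vx, vy). intros [x y]. cbn [fst snd]. split.
    + intros J. apply dom_in in J as [t J]. apply S in J. destruct J as (J1 & J2 & _).
      cbn in J1, J2. lia.
    + intros J. eapply in_dom. apply S. repeat split; cbn; lia.
  - intros [[x y] t] [[x' y'] u] J J' Hadj. apply S in J, J'.
    destruct J as (J1 & J2 & _), J' as (J1' & J2' & _).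
    unfold adjacent in Hadj. cbn in *. lia.
Qed.

Theorem theorem1 :
  exists C : nat, forall n : nat, (1 <= n)%nat ->
    exists (S : system) (P : supertile),
      system_wf S /\
      sys_temp S = 2%nat /\
      uniquely_assembles S P /\
      has_square_shape n P /\
      fully_connected (sys_glue S) P /\
      (stage_complexity S <= C * (Nat.log2 n + 1))%nat /\
      (glue_complexity S <= 4)%nat /\
      (tile_complexity S <= 14)%nat /\
      (bin_complexity S <= 7)%nat.
Proof.
  (* There are 1 start stage, at most [2 * log2 (n - 1)] operations and 3 final stages. *)
  exists 4%nat. intros n Hn.
  destruct (Nat.eq_dec n 1) as [->|Hn1].
  { destruct unit_square as (S & P & H1 & H2 & H3 & H4 & H5 & H6 & H7).
    exists S, P. rewrite H6. repeat (split; [assumption|]). split; [lia|exact H7]. }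
  (* The arms have length [n - 1]; the corner supplies the missing tile. *)
  destruct (binary_ops (Pos.of_nat (n - 1))) as (ops & E & L).
  rewrite Nat2Pos.id in L by lia.
  assert (En : fold_left op_length ops 1 = Z.of_nat n - 1) by lia. clear E.
  destruct (start_ready no_bins) as [HR HB].
  destruct (run_correct ops 1 1 _ (or_introl eq_refl) HR)
    as (U & fH & fV & r & r' & CH & CV & Y).
  rewrite En in CH, CV, Y.
  destruct (yields_inv _ _ Y) as (P & HP & SP).
  destruct (complexity_bounds _ (tiles_used_square_system ops)) as [B1 B2].
  exists (square_system ops), P.
  split; [|split; [reflexivity|split; [|split; [|split; [|split; [|
    split; [exact B1|split; [exact B2|]]]]]]]].
  - split; [cbn; lia|split; [apply Gl_valid|split; [discriminate|split]]].
    + split; [|apply run_wf]. intros b Hb j Hj. cbn in Hb.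
      repeat (destruct Hb as [<-|Hb]; [destruct Hj|]). destruct Hb.
    + intros j [<-|[]]. cbn [square_system sys_stages]. rewrite last_run. cbn. lia.
  - eapply uniquely_assembles_yields; eauto. split; [exact HB|exact U].
  - replace n with (Z.to_nat (Z.of_nat n - 1 + 1)) by lia.
    eapply square_has_square_shape; eauto.
  - eapply square_fully_connected; eauto.
  - unfold stage_complexity, square_system. cbn [sys_stages length]. rewrite length_run.
    pose proof (Nat.log2_le_mono (n - 1) n ltac:(lia)). lia.
  - unfold bin_complexity, square_system. cbn [sys_stages map].
    change (Nat.max (length start_stage) (list_max (map (@length bin) (run 1 ops))) <= 7)%nat.
    rewrite run_bins. destruct ops; cbn; lia.
Qed.
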